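(* Let $(A,\star_A)$ be an anti-associative algebra, $(B,\varrho,\mu,\star_B)$ an action of $(A,\star_A)$, and $\mathcal{H}:B\to A$ a homomorphic embedding tensor on $(A,\star_A)$ with respect to the action $(B,\varrho,\mu,\star_B)$. Then $B$ carries an anti-associative trialgebra structure $(B,\triangleright_{\mathcal{H}},\triangleleft_{\mathcal{H}},\vartriangle_{\mathcal{H}})$ given by $$a\triangleright_{\mathcal{H}}b=\varrho(\mathcal{H}(a))b,\qquad a\triangleleft_{\mathcal{H}}b=\mu(\mathcal{H}(b))a,\qquad a\vartriangle_{\mathcal{H}}b=a\star_B b,\qquad\forall a,b\in B.$$
   Context: All vector spaces and algebras are finite dimensional over a field $\mathbb{K}$ of characteristic zero. An anti-associative algebra $(A,\star)$ is a vector space with a bilinear product satisfying $(x\star y)\star z+x\star(y\star z)=0$. A representation of $(A,\star)$ is a triple $(V,\varrho,\mu)$ with $\varrho,\mu:A\to\mathrm{End}(V)$ linear and $\varrho(x)\varrho(y)=-\varrho(x\star y)$, $\mu(y)\mu(x)=-\mu(x\star y)$, $\mu(x)\varrho(y)=-\varrho(y)\mu(x)$ for all $x,y\in A$. For anti-associative algebras $(A,\star_A)$, $(B,\star_B)$, an action $(B,\varrho,\mu,\star_B)$ of $(A,\star_A)$ consists of linear maps $\varrho,\mu:A\to\mathrm{End}(B)$ such that $(B,\varrho,\mu)$ is a representation of $(A,\star_A)$ and, for all $x\in A$, $a,b\in B$: $\varrho(x)(a\star_B b)=-(\varrho(x)a)\star_B b$, $\mu(x)(a\star_B b)=-a\star_B(\mu(x)b)$,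 $(\mu(x)a)\star_B b=-a\star_B(\varrho(x)b)$. A homomorphic embedding tensor is a linear map $\mathcal{H}:B\to A$ with $\mathcal{H}(a)\star_A\mathcal{H}(b)=\mathcal{H}(\varrho(\mathcal{H}(a))b)=\mathcal{H}(\mu(\mathcal{H}(b))a)$ and $\mathcal{H}(a\star_B b)=\mathcal{H}(a)\star_A\mathcal{H}(b)$ for all $a,b\in B$. An anti-associative dialgebra $(D,\triangleright,\triangleleft)$ is a vector space with two bilinear operations satisfying $(x\triangleleft y)\triangleleft z+x\triangleleft(y\triangleleft z)=0$, $(x\triangleright y)\triangleright z+x\triangleright(y\triangleright z)=0$, $(x\triangleright y)\triangleleft z+x\triangleright(y\triangleleft z)=0$. An anti-associative trialgebra is a vector space $D$ with three bilinear operations $\triangleleft$ (left), $\triangleright$ (right), $\vartriangle$ (middle) such that $(D,\triangleright,\triangleleft)$ is an anti-associative dialgebra, $(D,\vartriangle)$ is an anti-associative algebra, and for all $x,y,z\in D$: $(x\triangleleft y)\triangleleft z+x\triangleleft(y\vartriangle z)=0$; $(x\vartriangle y)\triangleleft z+x\vartriangle(y\triangleleft z)=0$; $(x\triangleleft y)\vartriangle z+x\vartriangle(y\triangleright z)=0$; $(x\triangleright y)\vartriangle z+x\triangleright(y\vartriangle z)=0$; $(x\vartriangle y)\triangleright z+x\triangleright(y\triangleright z)=0$. *)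

(* Defs.v *)
From HB Require Import structures.
From mathcomp Require Import all_boot all_order all_algebra.

Set Implicit Arguments.
Unset Strict Implicit.
Unset Printing Implicit Defensive.

Import GRing.Theory.
Local Open Scope ring_scope.

Section AntiAssociative.
Variable K : fieldType.

Record anti_assoc_algebra (A : vectType K) (star : A -> A -> A) : Prop := {
  aaa_bilinear : bilinear_for *:%R *:%R star;
  aaa_anti_assoc : forall x y z, star (star x y) z + star x (star y z) = 0
}.

Record anti_assoc_representation (A V : vectType K) (star : A -> A -> A)
    (rho mu : {linear A -> 'End(V)}) : Prop := {
  rep_left : forall x y, (rho x \o rho y)%VF = - rho (star x y);
  rep_right : forall x y, (mu y \o mu x)%VF = - mu (star x y);
  rep_mid : forall x y, (mu x \o rho y)%VF = - (rho y \o mu x)%VF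
}.

(* starA and starB are meant to be anti-associative; this is a separate
   hypothesis. *)
Record anti_assoc_action (A B : vectType K) (starA : A -> A -> A)
    (rho mu : {linear A -> 'End(B)}) (starB : B -> B -> B) : Prop := {
  act_rep : anti_assoc_representation starA rho mu;
  act_left : forall x a b, rho x (starB a b) = - starB (rho x a) b;
  act_right : forall x a b, mu x (starB a b) = - starB a (mu x b);
  act_mid : forall x a b, starB (mu x a) b = - starB a (rho x b)
}.

Record homomorphic_embedding_tensor (A B : vectType K) (starA : A -> A -> A)
    (rho mu : {linear A -> 'End(B)}) (starB : B -> B -> B)
    (H : {linear B -> A}) : Prop := {
  het_left : forall a b, starA (H a) (H b) = H (rho (H a) b);
  het_right : forall a b, H (rho (H a) b) = H (mu (H b) a);
  het_hom : forall a b, H (starB a b) = starA (H a) (H b)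
}.

(* rt, lt and mid are the right, left and middle triangle operations. *)
Record anti_assoc_dialgebra (D : vectType K) (rt lt : D -> D -> D) : Prop := {
  aad_rt_bilinear : bilinear_for *:%R *:%R rt;
  aad_lt_bilinear : bilinear_for *:%R *:%R lt;
  aad_lt : forall x y z, lt (lt x y) z + lt x (lt y z) = 0;
  aad_rt : forall x y z, rt (rt x y) z + rt x (rt y z) = 0;
  aad_rt_lt : forall x y z, lt (rt x y) z + rt x (lt y z) = 0
}.

Record anti_assoc_trialgebra (D : vectType K) (rt lt mid : D -> D -> D) :
    Prop := {
  aat_dialgebra : anti_assoc_dialgebra rt lt;
  aat_algebra : anti_assoc_algebra mid;
  aat_lt_mid : forall x y z, lt (lt x y) z + lt x (mid y z) = 0;
  aat_mid_lt : forall x y z, lt (mid x y) z + mid x (lt y z) = 0;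
  aat_lt_mid_rt : forall x y z, mid (lt x y) z + mid x (rt y z) = 0;
  aat_rt_mid : forall x y z, mid (rt x y) z + rt x (mid y z) = 0;
  aat_mid_rt : forall x y z, rt (mid x y) z + rt x (rt y z) = 0
}.

End AntiAssociative.

(* Main.v *)
Require Import Defs.
From mathcomp Require Import all_boot all_order all_algebra.

Import GRing.Theory.
Local Open Scope ring_scope.

(** The action axioms are evaluated at elements [H a]. Since [H] turns each of
    the three operations of [B] into the product of [A] ([embedding_rt],
    [embedding_lt], [het_hom]), a nested operation inside [H] becomes a product
    [starA (H a) (H b)], and [rho] or [mu] of such a product is minus a
    composite of two operators, by the representation axioms. This gives the
    identities in which [H] meets a compound element; in the others the
    elements of [A] that act are images of single elements of [B], and the
    identity is an instance of the compatibility of [mu] with [rho] or of one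
    of the three compatibilities of the action with [starB]. *)

Section Representation.
Set Implicit Arguments.
Unset Strict Implicit.
Variables (K : fieldType) (A V : vectType K) (star : A -> A -> A).
Variables (rho mu : {linear A -> 'End(V)}).
Hypothesis hrep : anti_assoc_representation star rho mu.

Lemma rep_leftE x y v : rho x (rho y v) = - rho (star x y) v.
Proof. by rewrite -comp_lfunE (rep_left hrep) opp_lfunE. Qed.

Lemma rep_rightE x y v : mu y (mu x v) = - mu (star x y) v.
Proof. by rewrite -comp_lfunE (rep_right hrep) opp_lfunE. Qed.

Lemma rep_midE x y v : mu x (rho y v) = - rho y (mu x v).
Proof. by rewrite -comp_lfunE (rep_mid hrep) opp_lfunE comp_lfunE. Qed.

End Representation.

Section EmbeddingTensor.
Set Implicit Arguments.
Unset Strict Implicit.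
Variables (K : fieldType) (A B : vectType K).
Variables (starA : A -> A -> A) (starB : B -> B -> B).
Variables (rho mu : {linear A -> 'End(B)}) (H : {linear B -> A}).
Hypothesis hact : anti_assoc_action starA rho mu starB.
Hypothesis hH : homomorphic_embedding_tensor starA rho mu starB H.

Let hrep := act_rep hact.

Lemma embedding_rt a b : H (rho (H a) b) = starA (H a) (H b).
Proof. by rewrite (het_left hH). Qed.

Lemma embedding_lt a b : H (mu (H b) a) = starA (H a) (H b).
Proof. by rewrite -(het_right hH) embedding_rt. Qed.

Lemma bilinear_rt : bilinear_for *:%R *:%R (fun a b : B => rho (H a) b).
Proof.
by split=> [b k a a' | a k b b']; rewrite !linearP // add_lfunE scale_lfunE.
Qed.

Lemma bilinear_lt : bilinear_for *:%R *:%R (fun a b : B => mu (H b) a).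
Proof.
by split=> [b k a a' | a k b b']; rewrite !linearP // add_lfunE scale_lfunE.
Qed.

Lemma dialgebra_of_embedding_tensor :
  anti_assoc_dialgebra (fun a b : B => rho (H a) b) (fun a b : B => mu (H b) a).
Proof.
split; [exact: bilinear_rt | exact: bilinear_lt | | |] => x y z.
- by rewrite (rep_rightE hrep) embedding_lt addNr.
- by rewrite (rep_leftE hrep) embedding_rt addrN.
- by rewrite (rep_midE hrep) addNr.
Qed.

End EmbeddingTensor.

Theorem proposition4p11 (K : fieldType) (charK : [pchar K] =i pred0)
    (A B : vectType K) (starA : A -> A -> A) (starB : B -> B -> B)
    (rho mu : {linear A -> 'End(B)}) (H : {linear B -> A})
    (hA : anti_assoc_algebra starA) (hB : anti_assoc_algebra starB)
    (hact : anti_assoc_action starA rho mu starB)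
    (hH : homomorphic_embedding_tensor starA rho mu starB H) :
  anti_assoc_trialgebra
    (fun a b : B => rho (H a) b)
    (fun a b : B => mu (H b) a)
    (fun a b : B => starB a b).
Proof.
have hrep := act_rep hact.
split; [exact: dialgebra_of_embedding_tensor hact hH | exact: hB | | | | |]
  => x y z.
- by rewrite (rep_rightE hrep) (het_hom hH) addNr.
- by rewrite (act_right hact) addNr.
- by rewrite (act_mid hact) addNr.
- by rewrite (act_left hact) addrN.
- by rewrite (rep_leftE hrep) (het_hom hH) addrN.
Qed.
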